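(* Let $k,n,m$ be positive integers. Let $\pi=(P_1,\ldots,P_m)$ be a partition of $[n]$ and let $\vec{s}=(s_1,\ldots,s_m)$ be a vector of positive integers with $s_i\le |P_i|$ for every $1\le i\le m$ and $k\leq \sum_{i=1}^m s_i$. Then $$\chi(\mathrm{KG}^2(\pi;\vec{s};k))= \max\{1,\ n-M_{2,\pi}+1\}.$$
   Context: $[n]=\{1,\ldots,n\}$. The multiple Kneser graph $\mathrm{KG}^2(\pi;\vec{s};k)$ has as vertices all sets $A\subseteq P_1\cup\cdots\cup P_m$ with $|A|=k$ and $|A\cap P_i|\le s_i$ for all $1\le i\le m$; two vertices are adjacent if they are disjoint. $\chi$ is the chromatic number. Define $f_{2,\pi}(P_i)=2s_i$ if $|P_i|\ge 2s_i$, and $f_{2,\pi}(P_i)=|P_i|$ otherwise. Define $$M_{2,\pi}=\max\Big\{2k-1+\sum_{j=1}^t\big(|P_{i_j}|-f_{2,\pi}(P_{i_j})\big)\Big\},$$ where the maximum is over all integers $t\ge 0$ and all choices of distinct indices $i_1,\ldots,i_t\in\{1,\ldots,m\}$ with $\sum_{j=1}^t f_{2,\pi}(P_{i_j})\le 2k-1$ (the choice $t=0$, with empty sums, is allowed). *)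

(* Defs.v *)
From HB Require Import structures.
From mathcomp Require Import all_boot all_order all_algebra.

Set Implicit Arguments.
Unset Strict Implicit.
Unset Printing Implicit Defensive.

Record sgraph := SGraph {
  svertex : finType;
  sedge : rel svertex;
  sedge_sym : symmetric sedge;
  sedge_irrefl : irreflexive sedge }.

Definition proper_coloring (G : sgraph) (c : nat)
    (f : {ffun svertex G -> 'I_c}) : bool :=
  [forall x, forall y, sedge x y ==> (f x != f y)].

Definition colorable (G : sgraph) (c : nat) : bool :=
  [exists f : {ffun svertex G -> 'I_c}, proper_coloring f].

Lemma colorable_card (G : sgraph) : exists c : nat, colorable G c.
Proof.
exists #|svertex G|; apply/existsP; exists [ffun x => enum_rank x].
apply/forallP => x; apply/forallP => y; apply/implyP => exy.
rewrite !ffunE (inj_eq enum_rank_inj).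
by apply: contraTneq exy => ->; rewrite sedge_irrefl.
Qed.

Definition chromatic_number (G : sgraph) : nat := ex_minn (colorable_card G).

(* The ground set {1, ..., n} is represented by 'I_n, and the index set
   {1, ..., m} by 'I_m.  [partition] excludes empty blocks, and injectivity
   makes blocks with distinct indices disjoint. *)
Definition ordered_partition (n m : nat) (P : 'I_m -> {set 'I_n}) : Prop :=
  injective P /\ partition [set P i | i : 'I_m] [set: 'I_n].

Section MultipleKneser.

Variables (n m : nat) (P : 'I_m -> {set 'I_n}) (s : 'I_m -> nat) (k : nat).

Definition kneser_set (A : {set 'I_n}) : bool :=
  [&& A \subset \bigcup_i P i, #|A| == k & [forall i, #|A :&: P i| <= s i]].

Definition kneser_vertex : finType := {A : {set 'I_n} | kneser_set A}.

(* The condition A != B is automatic for disjoint k-sets with k > 0; it keeps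
   the graph loopless for k = 0. *)
Definition kneser_adj : rel kneser_vertex :=
  fun A B => (A != B) && [disjoint val A & val B].

Lemma kneser_adj_sym : symmetric kneser_adj.
Proof. by move=> A B; rewrite /kneser_adj eq_sym disjoint_sym. Qed.

Lemma kneser_adj_irrefl : irreflexive kneser_adj.
Proof. by move=> A; rewrite /kneser_adj eqxx. Qed.

Definition multiple_kneser : sgraph :=
  SGraph kneser_adj_sym kneser_adj_irrefl.

Definition f2 (i : 'I_m) : nat :=
  if 2 * s i <= #|P i| then 2 * s i else #|P i|.

(* A choice of t distinct indices is a subset of 'I_m of cardinality t.  The
   set of admissible choices contains set0, so the default value 0 of \max is
   irrelevant.  Subtractions are not truncated: f2 i <= #|P i|, and k > 0 in
   use. *)
Definition M2 : nat :=
  \max_(I : {set 'I_m} | \sum_(i in I) f2 i <= 2 * k - 1)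
    (2 * k - 1 + \sum_(i in I) (#|P i| - f2 i)).

End MultipleKneser.

(* Main.v *)
Require Import Defs.
From HB Require Import structures.
From mathcomp Require Import all_boot all_order all_algebra.
From mathcomp Require Import zify.

Set Implicit Arguments.
Unset Strict Implicit.
Unset Printing Implicit Defensive.

Import Order.TTheory GRing.Theory Num.Theory.

(** The upper bound comes from the best choice of blocks [I] in [M2].  Put
    [U = \bigcup_(i in I) P i] and let [D] consist of
    [2 * k - 1 - \sum_(i in I) f2 i] elements outside [U] (of all of them if
    there are fewer).  Two disjoint vertices use together at most [f2 i]
    elements of each block [P i] of [U], hence at most [2 * k - 1] elements of
    [U :|: D].  So no two vertices inside [U :|: D] are disjoint: they form one
    colour class, and any other vertex can be coloured with an element it has
    outside [U :|: D] ([colorable_M2]).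

    The lower bound is a combinatorial Borsuk-Ulam argument on signed sets, the
    sets [X] of pairs (element, sign) in which no element has both signs.
    - For every sign function [s] with [s (negs X) = ~~ s X] on nonempty signed
      sets, the number of maximal chains of signed sets along which [s]
      alternates, with value [true] at the top, is odd ([full_chains_odd]).  The
      reason is that, modulo 2, such chains obey a boundary formula
      ([alt_chains_boundary]), which allows the removal of one coordinate at a
      time ([full_chainsD1]).  So if [h] is positive and grows strictly whenever
      a larger signed set has the other sign, then [h] takes a value at least
      the number of coordinates ([signed_height]).
    - From a proper colouring with [c] colours one builds such [s] and [h] with
      [h <= M2 - 1 + c], whence [n <= M2 - 1 + c] ([coloring_lower_bound]).
      When a side of [X] contains a vertex, [h X] is [M2 - 1] plus the largest
      colour of a vertex inside a side of [X], and the sign tells which side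
      has that colour; it cannot be both, as their vertices are disjoint.
      When neither side contains a vertex, [h] is a sum over the blocks.  A side
      with [a] elements in [P i] can give at most [minn a (s i)] of them to a
      vertex, so the two sides of [X] in [P i], of sizes [a] and [b], count for
      [minn a (s i) + minn b (s i)]; but once both are full, all [a + b] elements
      may be counted, which is exactly what [M2] pays for.  This height is blind
      to the growth of a full side in a block whose other side is not full;
      so the sign is read off from the full side of the first such block, and
      it does not change either. *)

(** * Sums modulo 2 *)

Lemma xor_sym_pairs (T : finType) (X : {set T}) (F : T -> T -> bool) :
    (forall x y, F x y = F y x) ->
  \big[addb/false]_(x in X) \big[addb/false]_(y in X :\ x) F x y = false.
Proof.
move=> symF.
have split_xy x : x \in X -> \big[addb/false]_(y in X :\ x) F x y =
    \big[addb/false]_(y in X | enum_rank x < enum_rank y) F x y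
    (+) \big[addb/false]_(y in X | enum_rank y < enum_rank x) F x y.
  move=> xX; rewrite (bigID (fun y => enum_rank x < enum_rank y)) /=.
  congr (_ (+) _); apply: eq_bigl => y; rewrite !inE -(inj_eq enum_rank_inj);
    by rewrite -val_eqE /=; case: ltngtP; rewrite ?andbF ?andbT.
rewrite (eq_bigr _ split_xy) big_split /= [X in _ (+) X](exchange_big_dep (mem X)) //=.
  set S := (X in X (+) _); set S' := (X in _ (+) X).
  suff -> : S' = S by rewrite addbb.
  by apply: eq_bigr => x xX; apply: eq_big => // y; rewrite xX.
by move=> x y _ /andP[].
Qed.

Lemma xor_existsP (T : finType) (X : {set T}) (F : T -> bool) :
  \big[addb/false]_(x in X) F x -> exists2 x, x \in X & F x.
Proof.
move=> sumF; case: (pickP (fun x => (x \in X) && F x)) => [x /andP[]|noF].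
  by exists x.
by move: sumF; rewrite big1 // => x xX; move: (noF x); rewrite xX.
Qed.

(** * Alternating chains of finite sets *)

Section AlternatingChains.

Variables (T : finType) (s : {set T} -> bool).

(** For [#|X| = d > 0], the parity of the number of chains of sets of cardinals
    1, ..., [d] that end with [X] and along which [s] alternates, with
    [s X = b]. *)
Fixpoint alt_chains d b (X : {set T}) : bool :=
  if d is d'.+1 then
    (s X == b) && \big[addb/false]_(x in X) alt_chains d' (~~ b) (X :\ x)
  else true.

Lemma alt_chainsS d b X : alt_chains d.+1 b X =
  (s X == b) && \big[addb/false]_(x in X) alt_chains d (~~ b) (X :\ x).
Proof. by []. Qed.

Arguments alt_chains : simpl never.

(** If [s X = false], the formula is the definition.  If [s X = true], the
    formula for the sets [X :\ x] turns the sum of their [false]-chains into the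
    sum of their [true]-chains, up to a sum over the ways to remove two elements
    of [X], each of which occurs in both orders. *)
Lemma alt_chains_boundary d X :
  alt_chains d.+1 true X (+) alt_chains d.+1 false X =
  \big[addb/false]_(x in X) alt_chains d true (X :\ x).
Proof.
elim: d X => [|d IHd] X; rewrite !alt_chainsS; case: (s X) => /=; rewrite ?addbF //.
transitivity (\big[addb/false]_(x in X) (alt_chains d.+1 true (X :\ x) (+)
    \big[addb/false]_(y in X :\ x) alt_chains d true (X :\ x :\ y))).
  by apply: eq_bigr => x _; rewrite -IHd addKb.
rewrite big_split /= [X in _ (+) X]xor_sym_pairs ?addbF // => x y.
by congr (alt_chains _ _ _); apply/setP => z; rewrite !inE andbCA.
Qed.

End AlternatingChains.

Arguments alt_chains : simpl never.

(** * Signed sets and antipodal sign functions *)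

Section SignedSets.

Variable I : finType.
Implicit Types (X Y : {set I * bool}) (J A : {set I}).

Definition side b X : {set I} := [set j | (j, b) \in X].
Definition signed X := [disjoint side true X & side false X].
Definition negs X : {set I * bool} := [set p | (p.1, ~~ p.2) \in X].
(** The signed set with support [J] that is positive on [A]; it depends only on
    [A :&: J]. *)
Definition signing A J : {set I * bool} :=
  [set p | (p.1 \in J) && (p.2 == (p.1 \in A))].

Lemma side_negs b X : side b (negs X) = side (~~ b) X.
Proof. by apply/setP => j; rewrite !inE. Qed.

Lemma sideS b X Y : X \subset Y -> side b X \subset side b Y.
Proof. by move=> sXY; apply/subsetP => j; rewrite !inE; apply: (subsetP sXY). Qed.

Lemma signed_signing A J : signed (signing A J).
Proof.
rewrite /signed; apply/pred0P => j /=; rewrite !inE /=.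
by case: (j \in A); rewrite ?andbF.
Qed.

Lemma negs_signing A J : negs (signing A J) = signing (J :\: A) J.
Proof.
apply/setP => -[j b]; rewrite !inE /=.
by case: (j \in J); rewrite ?andbF ?andbT // ; case: b; case: (j \in A).
Qed.

Lemma signingD1 A J x :
  signing A J :\ (x, x \in A) = signing A (J :\ x).
Proof.
apply/setP => -[j b]; rewrite !inE /= -pair_eqE /=.
have [->|] //= := eqVneq j x.
by case: (x \in J); case: b; case: (x \in A).
Qed.

Lemma eq_signing A A' J :
  {in J, A =i A'} -> signing A J = signing A' J.
Proof.
move=> eqA; apply/setP => -[j b]; rewrite !inE /=.
by case jJ: (j \in J); rewrite //= eqA.
Qed.

Lemma card_signing A J : #|signing A J| = #|J|.
Proof.
rewrite -(card_imset (mem J) (f := fun j => (j, j \in A))); last by move=> i j [].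
apply: eq_card => -[j b]; apply/idP/imsetP => [|[i iJ [-> ->]]].
  by rewrite inE /= => /andP[jJ /eqP ->]; exists j.
by rewrite inE /= eqxx andbT.
Qed.

Lemma big_signing (F : I * bool -> bool) A J :
  \big[addb/false]_(p in signing A J) F p =
  \big[addb/false]_(x in J) F (x, x \in A).
Proof.
rewrite -(big_imset (h := fun j => (j, j \in A)) F) /=; last by move=> ? ? _ _ [].
apply: eq_bigl => -[j b]; apply/idP/imsetP => [|[i iJ [-> ->]]].
  by rewrite inE /= => /andP[jJ /eqP ->]; exists j.
by rewrite inE /= eqxx andbT.
Qed.

Variable s : {set I * bool} -> bool.
Hypothesis s_odd : forall X, signed X -> X != set0 -> s (negs X) = ~~ s X.

Lemma signing_neq0 A J d : #|J| = d.+1 -> signing A J != set0.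
Proof. by move=> cJ; rewrite -card_gt0 card_signing cJ. Qed.

Lemma alt_chains_negs d b A J : #|J| = d ->
  alt_chains s d b (signing (J :\: A) J) = alt_chains s d (~~ b) (signing A J).
Proof.
elim: d b A J => // d IHd b A J cJ; rewrite !alt_chainsS.
rewrite -negs_signing s_odd ?signed_signing ?(signing_neq0 _ cJ) //.
rewrite negs_signing -eqb_negLR; congr (_ && _).
rewrite !big_signing; apply: eq_bigr => x xJ.
have cJx : #|J :\ x| = d by move: cJ; rewrite (cardsD1 x) xJ => -[].
rewrite !signingD1 -(IHd (~~ b) A) //; congr alt_chains.
by apply: eq_signing => y; rewrite !inE => /andP[-> ->].
Qed.

(** The parity of the number of alternating maximal chains of signed sets
    supported in [J], which end in the facets of a cross-polytope. *)
Definition full_chains J : bool :=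
  \big[addb/false]_(A : {set I} | A \subset J)
    alt_chains s #|J| true (signing A J).

(** Each facet with [x] positive is paired with its antipode, whose [true]-chains
    are its own [false]-chains, so the boundary formula applies to the pair.
    In the sum of these boundaries over the hemisphere of the facets with [x]
    positive, a face that lacks a coordinate [y != x] lies on two facets and
    cancels, while those that lack [x] are the facets on [J :\ x]. *)
Lemma full_chainsD1 J x : x \in J -> full_chains J = full_chains (J :\ x).
Proof.
move=> xJ; set d := #|J :\ x|.
have cJ : #|J| = d.+1 by rewrite (cardsD1 x) xJ.
transitivity (\big[addb/false]_(A : {set I} | (A \subset J) && (x \in A))
   \big[addb/false]_(y in J) alt_chains s d true (signing A (J :\ y))).
  rewrite /full_chains cJ (bigID (fun A : {set I} => x \in A)) /=.
  (* The facets with [x] negative are the antipodes of the others. *)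
  rewrite [X in _ (+) X](reindex_onto (setD J) (setD J)) /=; last first.
    by move=> A /andP[sAJ _]; rewrite setDDr setDv set0U; apply/setIidPr.
  rewrite [X in _ (+) X](eq_bigl (fun A : {set I} => (A \subset J) && (x \in A)));
    last first.
    move=> A; rewrite subsetDl !inE xJ andbT negbK setDDr setDv set0U /=.
    by rewrite andbC; congr (_ && _); apply/eqP/idP => [<-|/setIidPr//];
      rewrite subsetIl.
  rewrite -big_split /=; apply: eq_bigr => A _.
  rewrite alt_chains_negs // alt_chains_boundary big_signing.
  by apply: eq_bigr => y _; rewrite signingD1.
(* Sort the faces by the coordinate [y] that they lack. *)
rewrite exchange_big (bigD1 x) //= [X in _ (+) X]big1 ?addbF => [|y /andP[yJ yx]].
  rewrite /full_chains (reindex_onto (fun A => x |: A) (fun A => A :\ x)) /=.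
    apply: eq_big => A.
      rewrite subUset sub1set xJ setU11 andbT /= subsetD1.
      congr (_ && _); apply/eqP/idP => [<-|xA]; first by rewrite !inE eqxx.
      by rewrite setU1K.
    move=> _; congr (alt_chains _ _ _ _); apply: eq_signing => y.
    by rewrite !inE => /andP[/negPf ->].
  by move=> A /andP[_ xA]; rewrite setD1K.
(* Here [y != x]: the two signs of [y] give equal contributions. *)
rewrite (bigID (fun A : {set I} => y \in A)) /=.
rewrite [X in _ (+) X](reindex_onto (fun A => A :\ y) (fun A => y |: A)) /=; last first.
  by move=> A /andP[_ yA]; rewrite setU1K.
set S := (X in X (+) _); set S' := (X in _ (+) X).
suff -> : S' = S by rewrite addbb.
apply: eq_big => A; last first.
  move=> _; congr (alt_chains _ _ _ _); apply: eq_signing => z.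
  by rewrite !inE => /andP[-> _].
rewrite !inE eqxx /= andbT eq_sym yx /=.
apply/idP/idP => [/andP[/andP[sAJ xA] /eqP eA]|/andP[/andP[sAJ xA] yA]].
  by rewrite xA -eA subUset sub1set yJ sAJ setU11.
by rewrite xA setD1K // eqxx !andbT (subset_trans _ sAJ) // subsetDl.
Qed.

Lemma full_chains_odd : full_chains [set: I].
Proof.
suff H d J : #|J| = d -> full_chains J by apply: (H _ _ erefl).
elim: d J => [|d IHd] J cJ.
  rewrite (cards0_eq cJ) /full_chains cards0.
  by rewrite (big_pred1 set0) // => A; rewrite subset0.
have /set0Pn[x xJ] : J != set0 by rewrite -card_gt0 cJ.
rewrite (full_chainsD1 xJ); apply: IHd.
by move: cJ; rewrite (cardsD1 x) xJ => -[].
Qed.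

Variable h : {set I * bool} -> nat.
Hypothesis h_gt0 : forall X, signed X -> X != set0 -> 0 < h X.
Hypothesis h_jump : forall X Y, X \subset Y -> signed Y -> X != set0 ->
  s X != s Y -> h X < h Y.

Lemma card_le_height d b A J : #|J| = d ->
  alt_chains s d b (signing A J) -> d <= h (signing A J).
Proof.
elim: d b A J => // d IHd b A J cJ; rewrite alt_chainsS => /andP[/eqP sb].
rewrite big_signing => /xor_existsP[x xJ]; rewrite signingD1.
have cJx : #|J :\ x| = d by move: cJ; rewrite (cardsD1 x) xJ => -[].
case: d => [|d] in IHd cJ cJx * => alt_x.
  by rewrite h_gt0 ?signed_signing ?(signing_neq0 _ cJ).
apply: leq_ltn_trans (IHd _ _ _ cJx alt_x) _.
apply: h_jump; rewrite ?signed_signing ?(signing_neq0 _ cJx) //.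
  by rewrite -signingD1 subsetDl.
by case/andP: alt_x => /eqP -> _; rewrite sb; case: (b).
Qed.

(** A form of Tucker's lemma: along an alternating maximal chain, which exists
    because the number of them is odd, the height grows at every step. *)
Lemma signed_height : exists2 X, signed X & #|I| <= h X.
Proof.
have := full_chains_odd; rewrite /full_chains -big_set /=.
move=> /xor_existsP[A _ altA]; exists (signing A [set: I]).
  exact: signed_signing.
by rewrite -cardsT; apply: card_le_height altA.
Qed.

End SignedSets.

(** * Vertices and blocks *)

Lemma colorable_fin (G : sgraph) (K : finType) (g : svertex G -> K) :
  (forall x y, sedge x y -> g x != g y) -> colorable G #|K|.
Proof.
move=> g_proper; apply/existsP; exists [ffun x => enum_rank (g x)].
apply/forallP => x; apply/forallP => y; apply/implyP => /g_proper.
by rewrite !ffunE (inj_eq enum_rank_inj).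
Qed.

Section KneserBlocks.

Variables (n m : nat) (P : 'I_m -> {set 'I_n}) (s : 'I_m -> nat) (k : nat).
Hypothesis coverP : \bigcup_i P i = [set: 'I_n].
Hypothesis disjP : forall i j x, x \in P i -> x \in P j -> i = j.

Lemma sum_card_blocks (I : {set 'I_m}) (A : {set 'I_n}) :
  \sum_(i in I) #|A :&: P i| = #|A :&: \bigcup_(i in I) P i|.
Proof.
have cardE (B : {set 'I_n}) : #|A :&: B| = \sum_(x in A) (x \in B : nat).
  rewrite -sum1_card big_mkcond [RHS]big_mkcond; apply: eq_bigr => x _.
  by rewrite inE; case: (x \in A); case: (x \in B).
rewrite (eq_bigr _ (fun i _ => cardE (P i))) exchange_big cardE /=.
apply: eq_bigr => x _; case: bigcupP => [[i iI xi]|noI].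
  rewrite (bigD1 i) //= xi big1 // => j /andP[_ ji].
  by case xj: (x \in P j) => //; rewrite (disjP xi xj) eqxx in ji.
by rewrite big1 // => i iI; case xi: (x \in P i) => //; case: noI; exists i.
Qed.

Lemma sum_card_all_blocks (A : {set 'I_n}) : \sum_i #|A :&: P i| = #|A|.
Proof.
by have := sum_card_blocks [set: 'I_m] A; rewrite !big_set /= coverP setIT.
Qed.

(** The size of the largest subset of [A] that meets each block [P i] in at most
    [s i] elements. *)
Definition capacity (A : {set 'I_n}) : nat := \sum_i minn #|A :&: P i| (s i).

Lemma capacity_subset c (A : {set 'I_n}) : c <= capacity A ->
  exists B : {set 'I_n},
    [/\ B \subset A, #|B| = c & forall i, #|B :&: P i| <= s i].
Proof.
elim: c => [|c IHc] c_lt.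
  exists set0; split; rewrite ?sub0set ?cards0 // => i.
  by rewrite set0I cards0.
have [B [sBA cB leB]] := IHc (ltnW c_lt).
have [i ltBi] : exists i, #|B :&: P i| < minn #|A :&: P i| (s i).
  apply/existsP; apply: contraLR c_lt => /existsPn noi.
  rewrite -leqNgt -cB -sum_card_all_blocks; apply: leq_sum => i _.
  by rewrite leqNgt noi.
have /subsetPn[x] : ~~ (A :&: P i \subset B :&: P i).
  by apply: contraL ltBi => /subset_leq_card; lia.
rewrite !inE => /andP[xA xi]; rewrite xi andbT => xB.
exists (x |: B); split; first by rewrite subUset sub1set xA.
  by rewrite cardsU1 xB cB.
move=> j; rewrite setIUl; apply: leq_trans (leq_card_setU _ _) _.
have [->|ji] := eqVneq j i.
  suff : #|[set x] :&: P i| <= 1 by move: ltBi; lia.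
  by rewrite -(cards1 x) subset_leq_card // subsetIl.
suff -> : [set x] :&: P j = set0 by rewrite cards0 leB.
apply/setP => y; rewrite !inE; case: eqVneq => //= ->.
by apply/negbTE; apply: contraNN ji => xj; rewrite (disjP xj xi).
Qed.

Lemma capacity_vertex (A : {set 'I_n}) : k <= capacity A ->
  exists v : kneser_vertex P s k, val v \subset A.
Proof.
case/capacity_subset => B [sBA cB leB].
have vB : kneser_set P s k B.
  by rewrite /kneser_set coverP subsetT cB eqxx; apply/forallP.
by exists (Sub B vB); rewrite SubK.
Qed.

(** * Height and sign when neither side contains a vertex *)

Hypothesis s_gt0 : forall i, 0 < s i.
Implicit Types X Y : {set 'I_n * bool}.

Definition load b X i : nat := #|side b X :&: P i|.
(** The first case is the only one that counts elements beyond the limit [s i]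
    of a side; [M2] leaves room for them. *)
Definition block_height X i : nat :=
  if (s i <= load true X i) && (s i <= load false X i)
  then load true X i + load false X i
  else minn (load true X i) (s i) + minn (load false X i) (s i).

Definition height X : nat := \sum_i block_height X i.

(** In these blocks the full side can grow while [block_height] stays the same. *)
Definition lopsided X i : bool :=
  (s i <= load true X i) != (s i <= load false X i).

(** The sign of an element is used only if no block is lopsided; the height then
    separates [X] from the sets comparable with it. *)
Definition block_sign X : bool :=
  if [pick i | lopsided X i] is Some i then s i <= load true X i
  else if [pick j | j \in side true X :|: side false X] is Some j
  then j \in side true X else true.

Lemma loadS b X Y i : X \subset Y -> load b X i <= load b Y i.
Proof. by move=> sXY; apply/subset_leq_card/setSI/sideS. Qed.

Lemma block_heightS X Y i : X \subset Y -> block_height X i <= block_height Y i.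
Proof.
move=> sXY; move: (loadS true i sXY) (loadS false i sXY); rewrite /block_height.
by do 2![case: ifP]; lia.
Qed.

Lemma block_height_eq X Y i : X \subset Y -> block_height X i = block_height Y i ->
  (forall b, (s i <= load b X i) = (s i <= load b Y i)) /\
  (~~ lopsided X i -> forall b, load b X i = load b Y i).
Proof.
move=> sXY; move: (loadS true i sXY) (loadS false i sXY).
rewrite /block_height /lopsided => leT leF eqh.
split=> [[]|/negPn/eqP lopF []]; move: eqh; do 2![case: ifP]; lia.
Qed.

Lemma block_sign_negs X : signed X -> X != set0 ->
  block_sign (negs X) = ~~ block_sign X.
Proof.
move=> sX X0; rewrite /block_sign.
have loadN b i : load b (negs X) i = load (~~ b) X i by rewrite /load side_negs.
rewrite !side_negs /= setUC.
have /eq_pick -> : lopsided (negs X) =1 lopsided X.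
  by move=> i; rewrite /lopsided !loadN eq_sym.
case: pickP => [i|_].
  rewrite loadN /lopsided /=.
  by case: (s i <= load true X i); case: (s i <= load false X i).
case: pickP => [j|noj].
  rewrite inE; case/orP => jX; rewrite jX.
    by rewrite (disjointFr sX).
  by rewrite (disjointFl sX).
case/set0Pn: X0 => -[j b] jX; move: (noj j); rewrite !inE.
by case: b jX => ->; rewrite ?orbT.
Qed.

(** If the height does not grow, neither does any [block_height].  Then the same
    sides are full in [X] and in [Y], and in a block that is not lopsided [X]
    and [Y] coincide. *)
Lemma block_sign_jump X Y : X \subset Y -> block_sign X != block_sign Y ->
  height X < height Y.
Proof.
move=> sXY; apply: contraNltn => le_h.
have eq_h i : block_height X i = block_height Y i.
  apply/eqP; rewrite eqn_leq block_heightS //=.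
  move: le_h; rewrite /height (bigD1 i) // [X in _ <= X](bigD1 i) //=.
  set a := \sum_(_ < _ | _) _; set b := \sum_(_ < _ | _) _.
  suff : b <= a by lia.
  by apply: leq_sum => j _; apply: block_heightS.
rewrite /block_sign.
have full_eq i b : (s i <= load b X i) = (s i <= load b Y i).
  by have [-> _] := block_height_eq sXY (eq_h i).
have /eq_pick <- : lopsided X =1 lopsided Y by move=> i; rewrite /lopsided !full_eq.
case: pickP => [i _|no_lop]; first by rewrite full_eq.
suff eq_side b : side b X = side b Y by rewrite !eq_side.
apply/eqP; rewrite eqEcard sideS //= -!sum_card_all_blocks.
apply: leq_sum => i _; have [_] := block_height_eq sXY (eq_h i).
by rewrite no_lop /load => ->.
Qed.

Lemma height_gt0 X : X != set0 -> 0 < height X.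
Proof.
case/set0Pn => -[x b] xX.
have /bigcupP[i _ xi] : x \in \bigcup_i P i by rewrite coverP.
rewrite /height (bigD1 i) //= addn_gt0; apply/orP; left.
have load_gt0 : 0 < load b X i.
  by rewrite card_gt0; apply/set0Pn; exists x; rewrite !inE xX.
by rewrite /block_height; move: (s_gt0 i); case: b {xX} load_gt0; case: ifP; lia.
Qed.

(** The blocks with both sides full form an admissible choice in [M2]: each has
    [f2 = 2 * s i], and by capacity their [f2] add up to at most [2 * k - 2].  In
    such a block the height exceeds the capacity by at most [#|P i| - 2 * s i]. *)
Lemma height_lt_M2 X : signed X ->
    (forall b : bool, capacity (side b X) < k) ->
  height X < M2 P s k.
Proof.
move=> sX cap_lt; pose I := [set i | s i <= load true X i & s i <= load false X i].
have load_le i : load true X i + load false X i <= #|P i|.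
  rewrite -cardsUI setIACA (disjoint_setI0 sX) set0I cards0 addn0.
  by rewrite -setIUl subset_leq_card // subsetIr.
have fI i : i \in I -> f2 P s i = 2 * s i.
  by rewrite inE /f2 => /andP[]; move: (load_le i); case: ifP; lia.
have sumE : capacity (side true X) + capacity (side false X) =
    \sum_i (minn (load true X i) (s i) + minn (load false X i) (s i)).
  by rewrite big_split.
have capI : \sum_(i in I) f2 P s i <=
    capacity (side true X) + capacity (side false X).
  rewrite sumE [X in _ <= X](bigID (mem I)) /=.
  apply: leq_trans (leq_addr _ _); apply: leq_sum => i iI.
  by rewrite fI //; move: iI; rewrite inE; lia.
have := cap_lt true; have := cap_lt false => ltF ltT.
have admI : \sum_(i in I) f2 P s i <= 2 * k - 1 by lia.
apply: leq_trans (leq_bigmax_cond _ admI); set S := (X in _ + X).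
suff : height X <= capacity (side true X) + capacity (side false X) + S by lia.
rewrite sumE /S [X in _ + X]big_mkcond -big_split; apply: leq_sum => i _ /=.
rewrite /block_height; case: ifP => iI; last by case: ifP; lia.
have iI' : i \in I by rewrite inE.
rewrite iI' fI //; case/andP: iI => /minn_idPr -> /minn_idPr ->.
by rewrite addnn -mul2n -maxnE leq_max load_le orbT.
Qed.

(** * Lower bound from a proper colouring *)

Hypothesis k_gt0 : 0 < k.

Lemma M2_gt0 : 0 < M2 P s k.
Proof.
have adm0 : \sum_(i in (set0 : {set 'I_m})) f2 P s i <= 2 * k - 1 by rewrite big_set0.
by apply: leq_trans (leq_bigmax_cond _ adm0); lia.
Qed.

Section Coloring.

Variables (c : nat) (f : {ffun kneser_vertex P s k -> 'I_c}).
Hypothesis proper_f : @proper_coloring (multiple_kneser P s k) c f.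

(** Colours are counted from 1, so that 0 means that the side contains no
    vertex. *)
Definition top_color b X : nat :=
  \max_(v : kneser_vertex P s k | val v \subset side b X) (f v).+1.

Lemma top_colorS b X Y : X \subset Y -> top_color b X <= top_color b Y.
Proof.
move=> sXY; apply/bigmax_leqP => v vX.
apply: (leq_bigmax_cond (F := fun v => (f v).+1)).
exact: subset_trans vX (sideS _ sXY).
Qed.

Lemma top_color_le b X : top_color b X <= c.
Proof. by apply/bigmax_leqP => v _. Qed.

Lemma top_color_negs b X : top_color b (negs X) = top_color (~~ b) X.
Proof. by rewrite /top_color side_negs. Qed.

Lemma top_color_eq0 b X : top_color b X = 0 -> capacity (side b X) < k.
Proof.
move=> t0; rewrite ltnNge; apply/negP => /capacity_vertex[v vX].
suff : 0 < top_color b X by rewrite t0.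
by apply: leq_trans (leq_bigmax_cond (F := fun v => (f v).+1) _ vX).
Qed.

Lemma top_color_attained b X : 0 < top_color b X ->
  exists2 v : kneser_vertex P s k, val v \subset side b X & top_color b X = (f v).+1.
Proof.
rewrite /top_color; case: (pickP (fun v : kneser_vertex P s k => val v \subset side b X)).
  move=> v0 v0X _; have [|v vX ->] := @eq_bigmax_cond _
    (fun v : kneser_vertex P s k => val v \subset side b X) (fun v => (f v).+1).
    by apply/card_gt0P; exists v0.
  by exists v.
by move=> nov; rewrite big_pred0.
Qed.

(** Vertices of the same colour in the two sides would be disjoint, hence
    adjacent. *)
Lemma top_color_neq X : signed X -> top_color true X = top_color false X ->
  top_color true X = 0.
Proof.
move=> sX eqt; apply/eqP; rewrite -leqn0 leqNgt; apply/negP => t_gt0.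
have [v vX tv] := top_color_attained t_gt0.
have [|w wX tw] := @top_color_attained false X; first by rewrite -eqt.
have dvw : [disjoint val v & val w].
  exact: disjointWl vX (disjointWr wX sX).
have fvw : f v = f w by apply/val_inj/succn_inj; rewrite -tv -tw.
have vw : v != w.
  apply: contraL dvw => /eqP <-; rewrite -setI_eq0 setIid -card_gt0.
  by case/and3P: (valP v) => _ /eqP -> _.
have adj_vw : @kneser_adj n m P s k v w by rewrite /kneser_adj vw.
by have /forallP/(_ v)/forallP/(_ w)/implyP/(_ adj_vw)/eqP := proper_f.
Qed.

Definition color_height X : nat :=
  let t := maxn (top_color true X) (top_color false X) in
  if t == 0 then height X else (M2 P s k).-1 + t.

Definition color_sign X : bool :=
  if maxn (top_color true X) (top_color false X) == 0 then block_sign X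
  else top_color false X < top_color true X.

Lemma color_height_le X : signed X -> color_height X <= (M2 P s k).-1 + c.
Proof.
move=> sX; rewrite /color_height.
have := top_color_le true X; have := top_color_le false X.
case: ifP => [t0 _ _|]; last by lia.
suff : height X < M2 P s k by lia.
apply: height_lt_M2 => // b; apply: top_color_eq0.
by case: b; lia.
Qed.

Lemma color_sign_negs X : signed X -> X != set0 ->
  color_sign (negs X) = ~~ color_sign X.
Proof.
move=> sX X0; rewrite /color_sign !top_color_negs /= maxnC.
case: ifP => [_|]; first exact: block_sign_negs.
by have := top_color_neq sX; lia.
Qed.

Lemma color_height_gt0 X : signed X -> X != set0 -> 0 < color_height X.
Proof. by move=> _ X0; rewrite /color_height; case: ifP; [rewrite height_gt0|lia]. Qed.

(** When [X] and [Y] have the same positive top colour, the side of [X] that has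
    it only grows, so [Y] has it on that side too and the signs agree. *)
Lemma color_sign_jump X Y : X \subset Y -> signed Y -> X != set0 ->
  color_sign X != color_sign Y -> color_height X < color_height Y.
Proof.
move=> sXY sY X0.
have := top_colorS true sXY; have := top_colorS false sXY => leF leT.
rewrite /color_sign /color_height.
have [tX|tX] := eqVneq (maxn (top_color true X) _) 0;
  have [tY|tY] := eqVneq (maxn (top_color true Y) _) 0; last 2 first.
- by lia.
- by have := top_color_neq sY; lia.
- exact: block_sign_jump.
suff : height X < M2 P s k by lia.
have sX : signed X by exact: disjointWl (sideS _ sXY) (disjointWr (sideS _ sXY) sY).
apply: height_lt_M2 => // b; apply: top_color_eq0.
by case: b; lia.
Qed.

Lemma coloring_lower_bound : n <= (M2 P s k).-1 + c.
Proof.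
have [X sX] := signed_height color_sign_negs color_height_gt0 color_sign_jump.
by rewrite card_ord => /leq_trans -> //; apply: color_height_le.
Qed.

End Coloring.

(** * Upper bound from a set hitting most vertices *)

Lemma colorable_hitting (E : {set 'I_n}) :
    (forall v w : kneser_vertex P s k, [disjoint val v & E] ->
       [disjoint val w & E] -> ~~ [disjoint val v & val w]) ->
  colorable (multiple_kneser P s k) #|E|.+1.
Proof.
move=> meetE; have <- : #|{: option {x | x \in E}}| = #|E|.+1.
  by rewrite card_option card_sig.
pose g (v : kneser_vertex P s k) := [pick e : {x | x \in E} | val e \in val v].
apply: (@colorable_fin (multiple_kneser P s k) _ g) => v w /= /andP[_ dvw].
apply/eqP; rewrite /g; case: pickP => [e ev|no_v]; case: pickP => [e' ew|no_w] //.
  by case=> ee'; move: ew; rewrite -ee' (disjointFr dvw ev).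
have disjE (u : kneser_vertex P s k) :
    (fun e : {x | x \in E} => val e \in val u) =1 xpred0 -> [disjoint val u & E].
  move=> no_u; apply/pred0P => x /=; apply/negbTE/negP => /andP[xu xE].
  by move: (no_u (Sub x xE)); rewrite /= xu.
by move: (meetE v w (disjE v no_v) (disjE w no_w)); rewrite dvw.
Qed.

(** The reason for the form of [f2]: two disjoint vertices share a block within
    the limits [2 * s i] and [#|P i|]. *)
Lemma disjoint_in_block (v w : kneser_vertex P s k) i : [disjoint val v & val w] ->
  #|val v :&: P i| + #|val w :&: P i| <= f2 P s i.
Proof.
move=> dvw; rewrite /f2.
case/and3P: (valP v) => _ _ /forallP/(_ i); case/and3P: (valP w) => _ _ /forallP/(_ i).
have : #|val v :&: P i| + #|val w :&: P i| <= #|P i|.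
  rewrite -cardsUI setIACA (disjoint_setI0 dvw) set0I cards0 addn0.
  by rewrite -setIUl subset_leq_card // subsetIr.
by case: ifP; lia.
Qed.

(** In the proof [~: U :\: E] is the set [D] of elements added to the blocks of
    the best choice.  The truncated difference [n - M2] covers the case in which
    [D] is all of [~: U] and one colour suffices. *)
Lemma colorable_M2 : colorable (multiple_kneser P s k) (n - M2 P s k).+1.
Proof.
have [|I admI M2E] := @eq_bigmax_cond _
    (fun I : {set 'I_m} => \sum_(i in I) f2 P s i <= 2 * k - 1)
    (fun I : {set 'I_m} => 2 * k - 1 + \sum_(i in I) (#|P i| - f2 P s i)).
  by apply/card_gt0P; exists set0; rewrite unfold_in big_set0.
pose U := \bigcup_(i in I) P i; pose q := 2 * k - 1 - \sum_(i in I) f2 P s i.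
have /card_geqP[l [l_uniq l_size l_sub]] : #|~: U| - q <= #|~: U| by rewrite leq_subr.
pose E := [set x in l].
have cardE : #|E| = #|~: U| - q.
  by rewrite -l_size -(card_uniqP l_uniq); apply: eq_card => x; rewrite inE.
have sEU : E \subset ~: U by apply/subsetP => x; rewrite inE; apply: l_sub.
have -> : n - M2 P s k = #|E|.
  have f_le i : f2 P s i <= #|P i| by rewrite /f2; case: ifP; lia.
  have cardU : #|U| = \sum_(i in I) #|P i|.
    rewrite -[U]setTI -sum_card_blocks; by apply: eq_bigr => i _; rewrite setTI.
  have cardUC : #|U| + #|~: U| = n by rewrite cardsC card_ord.
  have fU : \sum_(i in I) f2 P s i <= #|U| by rewrite cardU; apply: leq_sum.
  rewrite cardE /M2 M2E sumnB // -cardU; move: fU cardUC admI; rewrite /q unfold_in.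
  by lia.
apply: colorable_hitting => v w vE wE; apply/negP => dvw.
have cardD : #|~: U :\: E| <= q.
  by rewrite cardsD (setIidPr sEU) cardE; lia.
have card_v (u : kneser_vertex P s k) : [disjoint val u & E] ->
    k = \sum_(i in I) #|val u :&: P i| + #|val u :&: (~: U :\: E)|.
  case/and3P: (valP u) => _ /eqP cu _ uE.
  rewrite sum_card_blocks -{1}cu -(cardsID U (val u)); congr (_ + _).
  apply: eq_card => x; rewrite !(in_setI, in_setD, in_setC).
  by case xu: (x \in val u); rewrite ?andbF //= (disjointFr uE xu) /= andbT.
have : #|val v :&: (~: U :\: E)| + #|val w :&: (~: U :\: E)| <= q.
  rewrite -cardsUI setIACA (disjoint_setI0 dvw) set0I cards0 addn0.
  by rewrite -setIUl (leq_trans (subset_leq_card (subsetIr _ _))).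
have : \sum_(i in I) #|val v :&: P i| + \sum_(i in I) #|val w :&: P i| <=
    \sum_(i in I) f2 P s i.
  by rewrite -big_split; apply: leq_sum => i _; apply: disjoint_in_block.
have := card_v v vE; have := card_v w wE; move: admI; rewrite /q unfold_in.
by lia.
Qed.

End KneserBlocks.

Theorem theorem2 (k n m : nat) (hk : 0 < k) (hn : 0 < n) (hm : 0 < m)
    (P : 'I_m -> {set 'I_n}) (hP : ordered_partition P)
    (s : 'I_m -> nat) (hs0 : forall i, 0 < s i)
    (hsP : forall i, s i <= #|P i|) (hks : k <= \sum_i s i) :
  ((chromatic_number (multiple_kneser P s k))%:Z
     = Num.max 1 (n%:Z - (M2 P s k)%:Z + 1))%R.
Proof.
case: hP => injP /and3P[/eqP covP trivP _].
have coverP : \bigcup_i P i = [set: 'I_n].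
  by rewrite -covP /cover big_imset //= => i j _ _; apply: injP.
have disjP i j x : x \in P i -> x \in P j -> i = j.
  move=> xi xj; apply: injP; apply/eqP; apply/negP => /negP Pij.
  have /trivIsetP/(_ (P i) (P j)) := trivP.
  rewrite !imset_f // => /(_ isT isT Pij) /pred0P/(_ x).
  by rewrite /= xi xj.
have [v _] : exists v : kneser_vertex P s k, val v \subset [set: 'I_n].
  apply: capacity_vertex => //; apply: leq_trans hks _.
  by apply: leq_sum => i _; rewrite setTI (minn_idPr (hsP i)).
have M2_pos := M2_gt0 P s hk.
rewrite /chromatic_number; case: ex_minnP => c /existsP[f proper_f] c_min.
have c_gt0 : 0 < c by apply: leq_ltn_trans (ltn_ord (f v)).
have c_le := c_min _ (colorable_M2 s disjP hk).
have c_ge := coloring_lower_bound coverP disjP hs0 hk proper_f.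
by lia.
Qed.
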